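(* Let $q\in\mathbb{N}$ with $q\geq 3$ and let $\mathcal{A}\subset\{0,1,2,\dots,q-1\}$ be a digit set such that (1) $1\notin\mathcal{A}$ and $q-1\in\mathcal{A}$, and (2) $\mathcal{A}$ contains no two consecutive integers. Let $K_1\subset\mathbb{R}$ be the attractor of the iterated function system $\left\{f_a(x)=\frac{x+a}{q}: a\in\mathcal{A}\right\}$, i.e. $$K_1=\left\{\sum_{i=1}^{\infty}\frac{a_i}{q^i}: a_i\in\mathcal{A}\text{ for all }i\right\}.$$ Let $s=\sum_{n=1}^{\infty}q^{-n!}$. Then $$K_1-s=\{x-s:x\in K_1\}\subset\mathbb{Q}^c.$$ *)

(* Defs.v *)
From HB Require Import structures.
From mathcomp Require Import all_boot all_order all_algebra.
From mathcomp Require Import all_classical all_reals all_analysis.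
From mathcomp Require Import ring lra zify.

Set Implicit Arguments.
Unset Strict Implicit.
Unset Printing Implicit Defensive.

Import Order.TTheory GRing.Theory Num.Theory.
Import numFieldNormedType.Exports.

Local Open Scope classical_set_scope.
Local Open Scope ring_scope.

Definition contraction (R : realType) (q a : nat) (x : R) : R :=
  (x + a%:R) / q%:R.

Definition is_attractor (R : realType) (q : nat) (A : set nat) (K : set R) :=
  [/\ K !=set0, compact K & K = \bigcup_(a in A) (contraction q a @` K)].

(* The value a 0 is irrelevant: digits are indexed from 1. *)
Definition digit_set_attractor (R : realType) (q : nat) (A : set nat) : set R :=
  [set x | exists a : nat -> nat, (forall i, (1 <= i)%N -> A (a i)) /\
     (\sum_(1 <= i < n.+1) (a i)%:R / q%:R ^+ i : R) @[n --> \oo] --> x].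
Arguments digit_set_attractor : clear implicits.

Definition liouville_sum (R : realType) (q : nat) : R :=
  limn (fun n => \sum_(1 <= k < n.+1) (q%:R : R) ^- k`!).

(* The limit defining liouville_sum exists, so it is not a default value. *)
Lemma liouville_sum_cvg (R : realType) (q : nat) : (1 < q)%N ->
  (\sum_(1 <= k < n.+1) (q%:R : R) ^- k`!) @[n --> \oo] --> liouville_sum R q.
Proof.
move=> q1; rewrite /liouville_sum.
have q1R : (1 : R) < q%:R by rewrite ltr1n.
have q0 : (0 : R) < q%:R by lra.
have -> : (fun n => \sum_(1 <= k < n.+1) (q%:R : R) ^- k`!) =
          series (fun k => (q%:R : R) ^- (k.+1)`!).
  by apply/funext => n; rewrite /series /= big_add1.
apply: (@series_le_cvg _ _ (geometric 1 (q%:R^-1 : R))).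
- by move=> n; rewrite invr_ge0 exprn_ge0// ltW.
- by move=> n; rewrite /geometric /= mul1r exprn_ge0// invr_ge0 ltW.
- move=> n; rewrite /geometric /= mul1r exprVn lef_pV2 ?posrE ?exprn_gt0//.
  rewrite ler_eXn2l// (leq_trans (leqnSn n))//.
  by elim: n.+1 => // m ih; rewrite factS; have := fact_gt0 m; nia.
- apply: is_cvg_geometric_series.
  by rewrite ger0_norm ?invr_ge0 ?ltW// invf_lt1.
Qed.

Section attractor.
Context (R : realType) (q : nat) (A : set nat).
Context (q1 : (1 < q)%N) (Aq : A `<=` [set a | (a < q)%N]) (A0 : A !=set0).

Let f := @contraction R q.
Let E := digit_set_attractor R q A.
Let S (a : nat -> nat) n : R := \sum_(1 <= i < n.+1) (a i)%:R / q%:R ^+ i.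

Let q1R : (1 : R) < q%:R. Proof. by rewrite ltr1n. Qed.
Let q0 : (0 : R) < q%:R. Proof. by have := q1R; lra. Qed.
Let qn0 : (q%:R : R) != 0. Proof. by rewrite gt_eqF. Qed.

Let S_0 a : S a 0 = 0. Proof. by rewrite /S big_geq. Qed.

Let S_r a n : S a n.+1 = S a n + (a n.+1)%:R / q%:R ^+ n.+1.
Proof. by rewrite /S big_nat_recr. Qed.

Let S_l a n : S a n.+1 = (S (fun i => a i.+1) n + (a 1)%:R) / q%:R.
Proof.
rewrite /S big_ltn// big_add1 /= expr1 mulrDl addrC mulr_suml; congr (_ + _).
by apply: eq_bigr => i _; rewrite exprSr invfM mulrA.
Qed.

Let cvgVq : (q%:R : R) ^- n @[n --> \oo] --> (0 : R).
Proof.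
under eq_fun do rewrite -exprVn.
by apply: cvg_expr; rewrite ger0_norm ?invr_ge0 ?ltW// invf_lt1.
Qed.

Let S_bd a : (forall i, (1 <= i)%N -> A (a i)) ->
  forall n, 0 <= S a n <= 1 - q%:R ^- n.
Proof.
move=> Aa; elim=> [|n /andP[l u]]; first by rewrite S_0 expr0 invr1 subrr lexx.
rewrite S_r; apply/andP; split.
  by rewrite addr_ge0// divr_ge0// exprn_ge0// ltW.
have aq : (a n.+1)%:R <= q%:R - 1 :> R.
  by rewrite lerBrDr natr1 ler_nat; apply: Aq; apply: Aa.
apply: (le_trans (lerD u (ler_wpM2r _ aq))); first by rewrite invr_ge0 exprn_ge0// ltW.
have qe : (q%:R ^+ n : R) != 0 by rewrite expf_neq0.
rewrite le_eqVlt; apply/orP; left; apply/eqP; rewrite exprS; field.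
by rewrite qe qn0.
Qed.

Let S_cvg a : (forall i, (1 <= i)%N -> A (a i)) -> cvgn (S a).
Proof.
move=> Aa; apply: nondecreasing_is_cvgn.
  apply/nondecreasing_seqP => n; rewrite S_r lerDl divr_ge0// exprn_ge0// ltW//.
exists 1 => _ [n _ <-]; have /andP[_ u] := S_bd Aa n.
by rewrite (le_trans u)// gerBl invr_ge0 exprn_ge0// ltW.
Qed.

Let E_itv : E `<=` `[0, 1].
Proof.
move=> x [a [Aa ax]].
apply: (@closed_cvg _ _ _ _ (S a) _ (@itv_closed _ R 0 1) _ _ ax).
apply: nearW => n; have /andP[l u] := S_bd Aa n.
rewrite /= in_itv /= -/(S a n) l /= (le_trans u)//.
Qed.

Let E_neq0 : E !=set0.
Proof.
have [d Ad] := A0; exists (limn (S (fun=> d))), (fun=> d); split => //.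
exact: S_cvg.
Qed.

Let f_cont a : continuous (f a).
Proof.
by move=> x; apply: cvgM; [apply: cvgD; [exact: cvg_id|exact: cvg_cst]|exact: cvg_cst].
Qed.

Let E_inv : E = \bigcup_(a in A) (f a @` E).
Proof.
apply/seteqP; split => [x [a [Aa ax]]|_ [d Ad [y [a [Aa ay]] <-]]].
  pose b i := a i.+1.
  have Ab i : (1 <= i)%N -> A (b i) by move=> _; apply: Aa.
  exists (a 1%N); first exact: Aa.
  exists (limn (S b)); first by exists b; split => //; exact: S_cvg.
  have h : (f (a 1%N) \o S b) @ \oo --> f (a 1%N) (limn (S b)).
    by apply: continuous_cvg; [exact: f_cont|exact: S_cvg].
  apply: (cvg_unique _ h) => //=.
  rewrite (_ : _ \o _ = fun n => S a n.+1); last first.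
    by apply/funext => n; rewrite S_l.
  by rewrite (cvg_shiftS (S a)).
pose b i := if i is i'.+1 then if i' is 0%N then d else a i' else d.
exists b; split; first by move=> [|[|i]] //= _; apply: Aa.
rewrite -/(S b) -(cvg_shiftS (S b)).
rewrite (_ : (fun n => S b n.+1) = f d \o S a).
  by apply: continuous_cvg; [exact: f_cont|exact: ay].
apply/funext => n; rewrite S_l /= /f /contraction; congr ((_ + _) / _).
by rewrite /S; apply: eq_big_nat => -[|i].
Qed.

Let bounded_sub K : (exists M, forall x, K x -> `|x| <= M) ->
  K `<=` \bigcup_(a in A) (f a @` K) -> K `<=` E.
Proof.
move=> [M KM] KK x Kx.
have /choice[g gP] : forall y : R, exists p : nat * R, K y ->
    [/\ A p.1, K p.2 & f p.1 p.2 = y].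
  move=> y; have [Ky|nKy] := pselect (K y); last by exists (0%N, 0).
  by have [a Aa [z Kz <-]] := KK _ Ky; exists (a, z).
pose y n := iter n (fun z => (g z).2) x.
have Ky n : K (y n) by elim: n => //= n ih; have [] := gP _ ih.
pose a i := (g (y i.-1)).1.
have Aa i : (1 <= i)%N -> A (a i) by move=> _; have [] := gP _ (Ky i.-1).
have xE n : S a n = x - y n / q%:R ^+ n.
  elim: n => [|n ih]; first by rewrite S_0 expr0 divr1 subrr.
  rewrite S_r ih /a /=; have [_ _] := gP _ (Ky n).
  rewrite /f /contraction => {1}<-.
  have qe : (q%:R ^+ n : R) != 0 by rewrite expf_neq0.
  by rewrite exprS; field; rewrite qe qn0.
exists a; split => //; rewrite -/(S a) (funext xE).
rewrite -[X in _ --> X]subr0; apply: cvgB; first exact: cvg_cst.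
apply: norm_cvg0.
have M0 : M * q%:R ^- n @[n --> \oo] --> 0.
  by rewrite -[X in _ --> X](mulr0 M); apply: cvgMl_tmp; exact: cvgVq.
apply: (squeeze_cvgr _ _ M0); last exact: cvg_cst.
apply: nearW => n; rewrite normr_ge0 /= normrM normfV (@ger0_norm _ (_ ^+ _)).
  by rewrite ler_wpM2r ?KM// invr_ge0 exprn_ge0// ltW.
by rewrite exprn_ge0// ltW.
Qed.

Let E_closed : closed E.
Proof.
pose U := \bigcup_(a in A) (f a @` closure E).
have Uc : closed U.
  apply: closed_bigcup.
    exact: (sub_finite_set Aq (finite_II q)).
  move=> a Aa; rewrite (_ : f a @` _ = (fun x => x * q%:R - a%:R) @^-1` closure E).
    apply: preimage_closed; last exact: closed_closure.
    move=> x _; apply: cvgB; last exact: cvg_cst.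
    by apply: cvgM; [exact: cvg_id|exact: cvg_cst].
  apply/seteqP; split => [_ [x Ex <-]|x Ex].
    by rewrite /= /f /contraction divfK// addrK.
  by exists (x * q%:R - a%:R) => //; rewrite /f /contraction subrK mulfK.
have sub : closure E `<=` E.
  apply: bounded_sub.
    exists 1 => x; have -> : `|x| <= 1 <-> x \in `[-1, 1] by rewrite in_itv /= ler_norml.
    move=> Ex; have : closure `[0 : R, 1] x by apply: closure_subset Ex; exact: E_itv.
    rewrite -(closure_id _).1; last exact: itv_closed.
    by rewrite /= !in_itv /= => /andP[x0 ->]; rewrite andbT; lra.
  rewrite -/U [X in _ `<=` X](closure_id _).1//; apply: closure_subset.
  rewrite {1}E_inv => _ [a Aa [x Ex <-]]; exists a => //; exists x => //.
  exact: subset_closure.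
by move=> x /sub.
Qed.

(* The digit expansion set is the unique non-empty compact invariant set. *)
Lemma is_attractorE (K : set R) :
  is_attractor q A K <-> K = digit_set_attractor R q A.
Proof.
split=> [[[k Kk] Kc KE]|->]; last first.
  split; [exact: E_neq0| |exact: E_inv].
  exact: subclosed_compact E_closed (@segment_compact R 0 1) E_itv.
apply/seteqP; split.
  apply: bounded_sub; last by rewrite -/f in KE; rewrite -KE.
  have [M [_ MK]] := compact_bounded Kc.
  by exists (M + 1) => x Kx; apply: (MK (M + 1)) => //; rewrite ltrDl.
move=> x [a [Aa ax]].
have Kn n b : (forall i, (1 <= i)%N -> A (b i)) -> K (S b n + k / q%:R ^+ n).
  elim: n b => [|n ih] b Ab; first by rewrite S_0 add0r expr0 divr1.
  rewrite KE; exists (b 1%N); first exact: Ab.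
  exists (S (fun i => b i.+1) n + k / q%:R ^+ n); first by apply: ih => i _; apply: Ab.
  have qe : (q%:R ^+ n : R) != 0 by rewrite expf_neq0.
  by rewrite S_l /contraction exprS; field; rewrite qe qn0.
have h : S a n + k / q%:R ^+ n @[n --> \oo] --> x.
  rewrite -[X in _ --> X]addr0; apply: cvgD; first exact: ax.
  by rewrite -(mulr0 k); apply: cvgMl_tmp; exact: cvgVq.
apply: (@closed_cvg _ _ _ _ (fun n => S a n + k / q%:R ^+ n) K _ _ _ h) => //.
  by apply: compact_closed => //; exact: Rhausdorff.
by apply: nearW => n; exact: Kn.
Qed.

End attractor.

(* Main.v *)
(** Write x - s = u / v with x in the attractor.  For m! <= k < (m+1)!, the
    scaled remainders w_k = v q^k (u/v + T_m - S_k), where S_k and T_m are the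
    partial sums of x and s, are integers with |w_k| < v and
    w_(k+1) = q w_k - v a_(k+1); they are nonnegative except within v steps of
    (m+1)!.  For m large, pigeonhole gives two equal remainders at least v steps
    apart.  Running both orbits forward, their digits stay equal, since unequal
    digits would differ by exactly 1.  When the later orbit reaches position
    (m+1)!, the new digit of s adds v to its remainder, and the bounds then force
    its digit to be one more than that of the earlier orbit: a contradiction. *)

Require Import Defs.
From mathcomp Require Import all_boot all_order all_algebra.
From mathcomp Require Import all_classical all_reals all_analysis.
From mathcomp Require Import ring lra zify.

Set Implicit Arguments.
Unset Strict Implicit.

Import Order.TTheory GRing.Theory Num.Theory.
Import numFieldNormedType.Exports.

Local Open Scope classical_set_scope.
Local Open Scope ring_scope.

(* [w'] is the remainder after the last step, where the expansion of s has its
   digit 1. *)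
Lemma no_perturbed_digit_orbit (A : set nat) (q v l : nat) (c : nat -> nat)
    (w : nat -> int) (w' : int) :
  (forall a, ~ (A a /\ A a.+1)) -> (forall i, A (c i)) ->
  (0 < v)%N -> (v * v + v <= l.+1)%N ->
  (forall i, (i < l)%N -> w i.+1 = q%:Z * w i - v%:Z * (c i)%:Z) ->
  w' = q%:Z * w l - v%:Z * (c l)%:Z + v%:Z ->
  (forall i, (i <= l)%N -> - v%:Z < w i < v%:Z) ->
  (forall i, (i + v <= l.+1)%N -> 0 <= w i) ->
  0 <= w' < v%:Z -> False.
Proof.
move=> hA Ac v0 vl wS w'E wv w0 w'v.
have no_succ a b : A a -> A b -> b <> a.+1.
  by move=> Aa Ab E; apply: (hA a); rewrite -E.
(* The [v + 1] sampled positions [i * v] all precede the window of possibly negative remainders, so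
   only [v] values are available. *)
have iv (i : 'I_v.+1) : (i * v + v <= l.+1)%N.
  by have := ltn_ord i; nia.
have lt_v (i : 'I_v.+1) : (`|w (i * v)%N| < v)%N.
  have := w0 _ (iv i); have := wv (i * v)%N; have := iv i; lia.
pose f (i : 'I_v.+1) : 'I_v := Ordinal (lt_v i).
have [i [j ij wij]] : exists i, exists2 j : 'I_v.+1,
    (i < j)%N & w (i * v)%N = w (j * v)%N.
  have /injectivePn[i [j nij fij]] : ~~ injectiveb f.
    apply/negP => /injectiveP/leq_card; rewrite !card_ord; lia.
  have e : w (i * v)%N = w (j * v)%N.
    have := congr1 val fij; rewrite /=; have := w0 _ (iv i); have := w0 _ (iv j); lia.
  have [?|?|/val_inj E] := ltngtP i j; first by exists i, j.
    by exists j, i.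
  by rewrite E eqxx in nij.
have {}ij : (i * v + v <= j * v)%N by nia.
have wt t : (j * v + t <= l)%N -> w (i * v + t)%N = w (j * v + t)%N.
  elim: t => [|t ih] ht; first by rewrite !addn0.
  rewrite !addnS in ht *.
  have := wv (i * v + t).+1; have := wv (j * v + t).+1.
  rewrite !wS ?ih; try lia.
  have ndig := fun k k' => @no_succ (c k) (c k') (Ac k) (Ac k').
  have := ndig (i * v + t)%N (j * v + t)%N; have := ndig (j * v + t)%N (i * v + t)%N.
  move: (c (i * v + t)%N) (c (j * v + t)%N) (w _) => a b z n1 n2 h1 h2.
  (* Both successors lie strictly between [-v] and [v], so [v * |a - b| < 2 * v]; the case
     [|a - b| = 1] is excluded by [n1] and [n2]. *)
  by congr (_ - v%:Z * _); apply/eqP; nia.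
have jl : (j * v <= l)%N by have := iv j; lia.
have := wt (l - j * v)%N; rewrite subnKC// => /(_ (leqnn _)).
set k := (i * v + _)%N => wk.
have kl : (k < l)%N by rewrite /k; lia.
(* The spacing gives [k.+1 + v <= l.+1], so [w k.+1] lies in [[0, v)] like [w']; subtracting,
   [|c k + 1 - c l| < 1]. *)
have := w0 k.+1; have := wv k.+1; rewrite wS// wk => b1 b2.
apply: (no_succ _ _ (Ac k) (Ac l)).
by move: w'v; rewrite w'E; rewrite /k in kl b1 b2 *; nia.
Qed.

(** The intervals [[u n, u n + e n]] are nested, so each contains the limit. *)
Lemma nondecreasing_cvg_bounds (R : realType) (u e : nat -> R) (x : R) :
  (forall n, u n <= u n.+1) -> (forall n, u n.+1 + e n.+1 <= u n + e n) ->
  (forall n, 0 <= e n) -> u @ \oo --> x -> forall n, u n <= x <= u n + e n.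
Proof.
move=> uS ueS e0 ux n.
have un k : u n <= u (n + k)%N <= u n + e n - e (n + k)%N.
  elim: k => [|k]; first by rewrite addn0; lra.
  by rewrite addnS; have := uS (n + k)%N; have := ueS (n + k)%N; lra.
have {}ux : u (n + k)%N @[k --> \oo] --> x.
  have -> : (fun k => u (n + k)%N) = (fun k => u (k + n)%N).
    by apply/funext => k; rewrite addnC.
  by rewrite cvg_shiftn.
rewrite -(cvg_lim _ ux)//; apply/andP; split.
  by apply: limr_ge; [exact: cvgP ux|apply: nearW => k; case/andP: (un k)].
apply: limr_le; [exact: cvgP ux|apply: nearW => k].
by have := un k; have := e0 (n + k)%N; lra.
Qed.

Lemma digit_sum_bounds (R : realType) (q : nat) (a : nat -> nat) (x : R) :
  (0 < q)%N -> (forall i, (1 <= i)%N -> (a i < q)%N) ->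
  (\sum_(1 <= i < n.+1) (a i)%:R / q%:R ^+ i : R) @[n --> \oo] --> x ->
  forall n, \sum_(1 <= i < n.+1) (a i)%:R / q%:R ^+ i <= x
    <= \sum_(1 <= i < n.+1) (a i)%:R / q%:R ^+ i + q%:R ^- n.
Proof.
move=> q0 aq.
apply: (@nondecreasing_cvg_bounds R _ (fun n => q%:R ^- n)) => n.
- by rewrite [leRHS]big_nat_recr//= lerDl divr_ge0// exprn_ge0.
- rewrite big_nat_recr//= -addrA lerD2l.
  have qn : (q%:R : R) != 0 by rewrite pnatr_eq0 -lt0n.
  have qe : (q%:R : R) ^- n = q%:R / q%:R ^+ n.+1.
    by rewrite exprS; field; rewrite qn expf_neq0.
  rewrite qe -[X in _ + X]mul1r -mulrDl ler_wpM2r ?invr_ge0 ?exprn_ge0//.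
  by rewrite natr1 ler_nat aq.
- by rewrite invr_ge0 exprn_ge0.
Qed.

(** Each term is at least twice the next, so the factor 2 absorbs the tail; strictness comes from
    the positive next term. *)
Lemma liouville_sum_bounds (R : realType) (q : nat) : (1 < q)%N -> forall n,
  \sum_(1 <= k < n.+1) (q%:R : R) ^- k`! < liouville_sum R q
    <= \sum_(1 <= k < n.+1) (q%:R : R) ^- k`! + 2 * q%:R ^- (n.+1)`!.
Proof.
move=> q1.
have qf k : 0 < (q%:R : R) ^- k by rewrite invr_gt0 exprn_gt0// ltr0n; lia.
have H : forall n, \sum_(1 <= k < n.+1) (q%:R : R) ^- k`! <= liouville_sum R q
    <= \sum_(1 <= k < n.+1) (q%:R : R) ^- k`! + 2 * q%:R ^- (n.+1)`!.
  apply: (@nondecreasing_cvg_bounds R _ (fun n => 2 * q%:R ^- (n.+1)`!))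
    (@liouville_sum_cvg R q q1) => n.
  - by rewrite [leRHS]big_nat_recr//= lerDl ltW.
  - rewrite big_nat_recr//= -addrA lerD2l.
    suff : 2 * (q%:R : R) ^- (n.+2)`! <= q%:R ^- (n.+1)`! by lra.
    have n12 : ((n.+1)`!.+1 <= (n.+2)`!)%N.
      by rewrite [n.+2`!]factS; have := fact_gt0 n.+1; nia.
    rewrite -(subnKC n12) exprD exprS !invfM.
    have q2 : 2 * (q%:R : R)^-1 <= 1 by rewrite ler_pdivrMr ?mul1r ?ler_nat ?ltr0n//; lia.
    have q3 k : (q%:R : R) ^- k <= 1.
      by rewrite invf_le1 ?exprn_ege1 ?exprn_gt0 ?ltr0n ?ler1n//; lia.
    rewrite [leLHS](_ : _ = q%:R ^- (n.+1)`! *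
      (2 / q%:R / q%:R ^+ ((n.+2)`! - (n.+1)`!.+1))); last by ring.
    apply: ler_piMr; first exact: ltW.
    by apply: mulr_ile1 => //; rewrite ?ltW// mulr_ge0// invr_ge0.
  - by rewrite mulr_ge0// ltW.
move=> n; have /andP[_ ->] := H n; rewrite andbT.
have /andP[+ _] := H n.+1; rewrite big_nat_recr//=; have := qf (n.+1)`!; lra.
Qed.

Theorem theorem1p6 (R : realType) (q : nat) (A : set nat)
    (hq : (3 <= q)%N)
    (hA : A `<=` [set a | (a <= q - 1)%N])
    (hA1 : ~ A 1%N)
    (hAq : A (q - 1)%N)
    (hA2 : forall a : nat, ~ (A a /\ A a.+1)) :
  [set x - liouville_sum R q | x in digit_set_attractor R q A]
    `<=` @irrational R.
Proof.
move=> _ [x [a [Aa ax]] <-] [rho _].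
have [u d _] := ratP rho; rewrite fmorph_div /= ratr_nat ratr_int => rE.
set v := d.+1 in rE.
have vgt0 : (0 : R) < v%:R by rewrite ltr0n.
have qgt0 : (0 : R) < q%:R by rewrite ltr0n; lia.
have q_neq0 : (q%:R : R) != 0 by rewrite gt_eqF.
(* As [(m+1)! - m! = m * m! >= m], the stretch between these factorials has room for the
   pigeonhole. *)
pose m := (v * v + v)%N.
pose S n : R := \sum_(1 <= i < n.+1) (a i)%:R / q%:R ^+ i.
pose T n : R := \sum_(1 <= k < n.+1) q%:R ^- k`!.
have Sx n : S n <= x <= S n + q%:R ^- n.
  by apply: digit_sum_bounds ax n => [|i /Aa /hA /=]; lia.
have Ts n : T n < liouville_sum R q <= T n + 2 * q%:R ^- (n.+1)`!.
  exact: liouville_sum_bounds (ltnW hq) n.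
(* The form with [u / v] shows integrality; rewriting [u / v] as [x - s] gives
   [v * q^k * ((x - S k) - (s - T n))], from which the bounds follow. *)
pose W n k : R := v%:R * q%:R ^+ k * (u%:~R / v%:R + T n - S k).
have W_int n k : (n`! <= k)%N -> W n k \is a Num.int.
  move=> nk; rewrite /W mulrBr mulrDr rpredB ?rpredD//.
  - rewrite (_ : _ * _ = q%:R ^+ k * u%:~R); last by field; rewrite gt_eqF.
    by rewrite rpredM ?intr_int// rpredX// natr_int.
  - rewrite mulr_sumr big_nat rpred_sum// => i /andP[i0 il].
    have ik : (i`! <= k)%N by rewrite (leq_trans _ nk)// leq_fact.
    rewrite -(subnK ik) exprD mulrA mulfK ?expf_neq0//.
    by rewrite rpredM ?rpredX// natr_int.
  rewrite mulr_sumr big_nat rpred_sum// => i /andP[i0 il].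
  rewrite -(subnK (il : (i <= k)%N)) exprD [_ * (_ / _)]mulrA mulrAC [v%:R * _]mulrA.
  by rewrite mulfK ?expf_neq0// !rpredM ?rpredX ?natr_int.
have W_lt n k : W n k < v%:R.
  rewrite /W rE -mulrA gtr_pMr//.
  have /andP[_ Sk] := Sx k; have /andP[Tn _] := Ts n.
  rewrite mulrC -ltr_pdivlMr ?exprn_gt0// mul1r; lra.
have W_ge n k : - 2 * v%:R * q%:R ^+ k / q%:R ^+ n.+1`! <= W n k.
  rewrite /W rE (_ : _ / _ = v%:R * q%:R ^+ k * (- 2 / q%:R ^+ n.+1`!)); last by ring.
  rewrite ler_pM2l ?mulr_gt0 ?exprn_gt0//.
  have /andP[Sk _] := Sx k; have /andP[_ Tn] := Ts n; lra.
pose w i := Num.floor (W m (m`! + i)%N).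
have wE i : (w i)%:~R = W m (m`! + i)%N by rewrite /w floorK// W_int// leq_addr.
pose w' := Num.floor (W m.+1 m.+1`!).
have w'E : w'%:~R = W m.+1 m.+1`! by rewrite /w' floorK// W_int.
have Sr n : S n.+1 = S n + (a n.+1)%:R / q%:R ^+ n.+1 by rewrite /S big_nat_recr.
have W_S n k : W n k.+1 = q%:R * W n k - v%:R * (a k.+1)%:R.
  rewrite /W Sr exprS; field.
  by rewrite q_neq0 expf_neq0// gt_eqF.
pose l := (m.+1`! - m`!).-1.
have lE : (m`! + l).+1 = m.+1`!.
  by rewrite /l factS; have := fact_gt0 m; rewrite /m; nia.
(* At least [j] steps before [(n+1)!], the tail of s weighs at most [2 * v / q^j]: below [v] for
   [j = 1], and below 1 for [j = v] by [pow_gt]. *)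
have W_far n k j : (k + j <= n.+1`!)%N -> - 2 * v%:R / q%:R ^+ j <= W n k.
  move=> kj; apply: le_trans (W_ge n k).
  rewrite -[leRHS]mulrA ler_nM2l; last lra.
  rewrite ler_pdivrMr ?exprn_gt0// -(subnKC kj) !exprD.
  rewrite [leRHS](_ : _ = q%:R ^+ k * q%:R ^+ (n.+1`! - (k + j))); last first.
    by field; rewrite expf_neq0.
  by rewrite ler_peMr ?exprn_ge0// exprn_ege1// ler1n; lia.
have pow_gt k : (2 * k.+1 < q ^ k.+1)%N.
  by elim: k => [|k ih]; [rewrite expn1|rewrite expnS; nia].
have W_gap n k : (k + v <= n.+1`!)%N -> -1 < W n k.
  move=> kv; apply: lt_le_trans (W_far _ _ _ kv).
  rewrite ltr_pdivlMr ?exprn_gt0// mulN1r mulNr ltrN2 -natrX -natrM ltr_nat.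
  exact: pow_gt.
(* The new term of s, scaled by [v * q^((m+1)!)], is exactly [v]. *)
have W_T : W m.+1 m.+1`! = W m m.+1`! + v%:R.
  rewrite /W /T [X in _ + X - _]big_nat_recr//= -/(T _).
  by field; rewrite !expf_neq0 ?gt_eqF.
apply: (@no_perturbed_digit_orbit A q v l (fun i => a (m`! + i).+1) w w').
- exact: hA2.
- by move=> i; apply: Aa.
- by [].
- rewrite /l factS; have := fact_gt0 m; rewrite /m; nia.
- move=> i _; apply: (@intr_inj R).
  by rewrite rmorphB !rmorphM /= !wE addnS W_S.
- apply: (@intr_inj R).
  by rewrite rmorphD rmorphB !rmorphM /= w'E wE W_T -lE W_S.
- move=> i il; rewrite -!(ltr_int R) rmorphN /= wE W_lt andbT.
  apply: lt_le_trans (W_far _ _ 1%N _); last lia.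
  have q3 : (3 : R) <= q%:R by rewrite ler_nat.
  by rewrite expr1 ltr_pdivlMr//; nra.
- move=> i il; rewrite -ltzD1 -(ltr_int R) rmorphD /= wE -ltrBlDr sub0r W_gap//; lia.
(* For [w'] the next digit 1 of s sits at [(m+2)!], more than [v] positions away, so [W_gap]
   applies. *)
- rewrite -ltzD1 -!(ltr_int R) rmorphD /= w'E W_lt andbT -ltrBlDr sub0r W_gap//.
  by rewrite [m.+2`!]factS; have := fact_geq m.+1; rewrite /m; nia.
Qed.
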